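(* Let $f:Q\to\mathbb{R}$ be convex and satisfy the Lipschitz condition $|f(x)-f(y)|\le M_f\|x-y\|$ for all $x,y\in Q$, let $g:Q\to\mathbb{R}$ be convex and satisfy $|g(x)-g(y)|\le M_g\|x-y\|$ for all $x,y\in Q$, and let $x_*$ be a solution of $\min\{f(x):x\in Q,\ g(x)\le0\}$ with $d(x_* )\le\Theta_0^2$. Let $\varepsilon>0$. Then, after the stopping of the Adaptive Mirror Descent algorithm described in the context, run with accuracy $\varepsilon$ and with $I$ the set of indices of its productive steps, the following inequality holds: $$\min_{k\in I}f(x^k)-f(x_* )\le M_f\,\varepsilon .$$
   Context: $(E,\|\cdot\|)$ is a finite-dimensional normed space with dual $E^*$ and dual norm $\|y\|_*=\max\{\langle y,x\rangle:\|x\|\le1\}$; $Q\subset E$ is a closed convex set. $d:Q\to\mathbb{R}$ is a non-negative, continuously differentiable function that is $1$-strongly convex: $\langle\nabla d(x)-\nabla d(y),x-y\rangle\ge\|x-y\|^2$ for all $x,y\in Q$. The Bregman divergence is $V(x,y)=d(y)-d(x)-\langle\nabla d(x),y-x\rangle$, and for $x\in Q$, $p\in E^*$, $\mathrm{Mirr}_x(p)=\arg\min_{u\in Q}\{\langle p,u\rangle+V(x,u)\}$. $\nabla f(x)$, $\nabla g(x)$ denote subgradients of $f$, $g$ at $x$. Adaptive Mirror Descent with accuracy $\varepsilon$: set $x^0=\arg\min_{x\in Q}d(x)$, $I=\emptyset$, $N=0$. Repeat: if $g(x^N)\le\varepsilon\|\nabla g(x^N)\|_*$ (productive step), put $h_N=\varepsilon/\|\nabla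 f(x^N)\|_*$, $x^{N+1}=\mathrm{Mirr}_{x^N}(h_N\nabla f(x^N))$ and add $N$ to $I$; otherwise (non-productive step), put $h_N=\varepsilon/\|\nabla g(x^N)\|_*$, $x^{N+1}=\mathrm{Mirr}_{x^N}(h_N\nabla g(x^N))$. Then increase $N$ by $1$. Stop as soon as $2\Theta_0^2/\varepsilon^2\le N$.
   Formalization: Added: M_f ≥ 0, and at points x of Q not interior to Q the chosen subgradient satisfies ‖∇f(x)‖_* ≤ M_f (automatic at interior points); without this bound, arbitrary subgradients of f relative to Q at boundary points make the claim false. *)

(* Defs.v *)
From HB Require Import structures.
From mathcomp Require Import all_boot all_order all_algebra.
From mathcomp Require Import all_classical all_reals all_analysis.

Set Implicit Arguments.
Unset Strict Implicit.
Unset Printing Implicit Defensive.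
Import Order.TTheory GRing.Theory Num.Theory.
Import numFieldNormedType.Exports.

Local Open Scope classical_set_scope.
Local Open Scope ring_scope.

(* Finite-dimensional normed spaces. *)
#[short(type="finNormedModType")]
HB.structure Definition FinNormedModule (R : numFieldType) :=
  {E of NormedModule R E & Vector R E}.

Section Defs.
Context {R : realType} {E : finNormedModType R}.

(* In finite dimension E^* consists of all linear functionals. *)
Definition dual : Type := {linear E -> R^o}.

(* The supremum is attained since the unit ball of E is compact. *)
Definition dual_norm (p : E -> R) : R :=
  sup [set p x | x in [set x : E | `|x| <= 1]].

Definition is_argmin (A : set E) (F : E -> R) (u : E) : Prop :=
  A u /\ forall v, A v -> F u <= F v.

(* The inequality is only required on Q, the domain of f. *)
Definition is_subgradient (Q : set E) (f : E -> R) (x : E) (p : dual) : Prop :=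
  forall y, Q y -> f x + p (y - x) <= f y.

(* d is differentiable relatively to Q (one-sidedly at boundary points), with
   gradient gd continuous for the dual norm.  When Q has empty interior gd is
   not unique, but gd x (y - x) is, for x and y in Q. *)
Definition is_C1_on (Q : set E) (d : E -> R) (gd : E -> dual) : Prop :=
  forall x, Q x ->
    (fun y => d y - d x - gd x (y - x) : R^o) =o_ (within Q (nbhs x))
      (fun y => y - x) /\
    dual_norm (gd y \- gd x) @[y --> within Q (nbhs x)] --> (0 : R).

Definition strongly_convex1 (Q : set E) (gd : E -> dual) : Prop :=
  forall x y, Q x -> Q y -> `|x - y| ^+ 2 <= gd x (x - y) - gd y (x - y).

Definition bregman (d : E -> R) (gd : E -> dual) (x y : E) : R :=
  d y - d x - gd x (y - x).

Definition is_Mirr (Q : set E) (d : E -> R) (gd : E -> dual)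
    (x : E) (p : dual) (u : E) : Prop :=
  is_argmin Q (fun v => p v + bregman d gd x v) u.

Section AdaptiveMirrorDescent.
Variables (Q : set E) (d : E -> R) (gd : E -> dual).
Variables (g : E -> R) (gf gg : E -> dual) (Theta0 eps : R).

Definition productive (x : E) : bool := g x <= eps * dual_norm (gg x).

(* If p = 0 then eps / dual_norm p = 0 by the convention on division by 0; the
   direction of the step vanishes, whatever its length. *)
Definition amd_step (x x' : E) : Prop :=
  let p := if productive x then gf x else gg x in
  is_Mirr Q d gd x ((eps / dual_norm p) \*: p) x'.

(* The iterates x 0, ..., x N when the algorithm stops after N steps.  The
   stopping test is evaluated at the end of each pass of the loop, hence N is
   the least positive integer that passes it. *)
Definition amd_run (x : nat -> E) (N : nat) : Prop :=
  [/\ is_argmin Q d (x 0%N),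
      forall k, (k < N)%N -> amd_step (x k) (x k.+1),
      (0 < N)%N,
      2 * Theta0 ^+ 2 / eps ^+ 2 <= N%:R &
      forall k, (0 < k < N)%N -> k%:R < 2 * Theta0 ^+ 2 / eps ^+ 2].

Definition productive_steps (x : nat -> E) (N : nat) : seq nat :=
  [seq k <- iota 0 N | productive (x k)].

End AdaptiveMirrorDescent.
End Defs.

Arguments dual {R} E.

(* Main.v *)
(* The point minimizing <p, u> + V(x, u) satisfies a first-order optimality
   condition; with V(x, y) >= |x - y|^2 / 2 and AM-GM it yields, for the step
   with direction p and length h,
     h <p, x - xstar> <= h^2 |p|^2 / 2 + V(x, xstar) - V(x', xstar).
   With h = eps / |p|, the potential V(., xstar) drops by more than eps^2 / 2
   as soon as <p, x - xstar> > eps |p|.  This holds at every non-productive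
   step, because g xstar <= 0, and also at every productive step if
   f x^k - f xstar > Mf eps for all k in I (for instance if I is empty).  Since
   V(x^0, xstar) <= Theta0^2, this would give N eps^2 / 2 < Theta0^2, against
   the stopping rule. *)
Require Import Defs.
From mathcomp Require Import all_boot all_order all_algebra.
From mathcomp Require Import all_classical all_reals all_analysis.
From mathcomp Require Import ring lra.
Import Order.TTheory GRing.Theory Num.Theory.
Import numFieldNormedType.Exports.
Local Open Scope classical_set_scope.
Local Open Scope ring_scope.

(** * Equivalence of norms and boundedness of functionals in finite dimension *)

Section FiniteDimension.
Import VectorInternalTheory.

Lemma linear_rV_bounded (R : realType) (n : nat) (V : normedModType R)
    (h : {linear 'rV[R]_n -> V}) :
  exists2 K : R, 0 <= K & forall c, `|h c| <= K * `|c|.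
Proof.
exists (\sum_(i < n) `|h 'e_i|) => [|c]; first exact: sumr_ge0.
rewrite [X in h X]row_sum_delta linear_sum mulr_suml.
apply: (le_trans (ler_norm_sum _ _ _)); apply: ler_sum => i _.
rewrite linearZ normrZ mulrC ler_wpM2l//.
rewrite [leRHS]/Num.Def.normr /= mx_normrE.
exact: (le_bigmax _ (fun ij => `|c ij.1 ij.2|) (0, i)).
Qed.

Lemma linear_rV_continuous (R : realType) (n : nat) (V : normedModType R)
    (h : {linear 'rV[R]_n -> V}) : continuous h.
Proof.
have [K K0 hK] := linear_rV_bounded R n V h.
apply/bounded_linear_continuous/bounded_funP => r; exists (K * r) => c cr.
by rewrite (le_trans (hK c))// ler_wpM2l.
Qed.

(** By compactness the norm of [r2v c] has a positive minimum on the unit sphere of coordinates; its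
    inverse serves as [m], by homogeneity. *)
Lemma coord_bounded (R : realType) (E : finNormedModType R) :
  exists2 m : R, 0 <= m & forall v : E, `|v2r v| <= m * `|v|.
Proof.
(* In dimension 0 the coordinate sphere is empty and carries no minimum. *)
have [v0|] := pselect (forall v : E, v2r v = 0).
  by exists 0 => // v; rewrite v0 normr0 mul0r.
move=> /existsNP[v0 /eqP v0N0].
pose S : set 'rV[R]_(dim E) := [set c | `|c| = 1].
have S0 : S !=set0.
  exists (`|v2r v0|^-1 *: v2r v0); rewrite /S /= normrZ normfV normr_id.
  by rewrite mulVf// normr_eq0.
have cS : compact S.
  apply: (@bounded_closed_compact R _ S).
    by exists 1; split=> [|M M1 c /= ->]; [exact: real1|exact: ltW].
  rewrite -[S]/((fun c : 'rV[R]_(dim E) => `|c|) @^-1` [set x | x = 1]).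
  by apply: (preimage_closed _ (@closed_eq R 1)) => c _; exact: norm_continuous.
have cN : {within S, continuous (fun c => `|r2v c : E|)}.
  apply: continuous_subspaceT => c; apply: continuous_comp.
    exact: (linear_rV_continuous R _ E r2v).
  exact: norm_continuous.
have [c0] := compact_EVT_min S0 cS cN.
rewrite inE => Sc0 minc0.
have c0N0 : 0 < `|r2v c0 : E|.
  rewrite normr_gt0; apply/eqP => c00.
  have : c0 = 0 by rewrite -(r2vK c0) c00 linear0.
  by move: Sc0 => /[swap] -> /eqP; rewrite /S/= normr0 eq_sym oner_eq0.
exists `|r2v c0 : E|^-1 => [|v]; first by rewrite invr_ge0.
have [->|vN0] := eqVneq (v2r v) 0; first by rewrite normr0 mulr_ge0// invr_ge0.
rewrite mulrC ler_pdivlMr//.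
have := minc0 (`|v2r v|^-1 *: v2r v).
have -> : r2v (`|v2r v|^-1 *: v2r v) = `|v2r v|^-1 *: v.
  by rewrite linearZ /= v2rK.
rewrite normrZ normfV normr_id.
rewrite ler_pdivlMl ?normr_gt0//; apply.
by rewrite inE /S/= normrZ normfV normr_id mulVf// normr_eq0.
Qed.

Lemma dual_bounded (R : realType) (E : finNormedModType R) (p : dual E) :
  exists K : R, forall v, `|p v| <= K * `|v|.
Proof.
have [m m0 hm] := coord_bounded R E.
have [K K0 hK] := linear_rV_bounded R _ _
  ((p \o r2v)%FUN : {linear 'rV[R]_(dim E) -> R^o}).
exists (K * m) => v; rewrite -[X in p X]v2rK.
by rewrite (le_trans (hK _))// -mulrA ler_wpM2l.
Qed.

End FiniteDimension.

(** * The dual norm *)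

Section Dual.
Context {R : realType} {E : finNormedModType R}.
Implicit Types (p : dual E) (u v : E).

Lemma dualZ p (t : R) v : p (t *: v) = t * p v.
Proof. exact: linearZ. Qed.

Lemma dualB p u v : p (u - v) = p u - p v.
Proof. exact: linearB. Qed.

Let dual_has_sup p : has_sup [set p x | x in [set x : E | `|x| <= 1]].
Proof.
have [K hK] := dual_bounded R E p; split.
  by exists (p 0); exists 0 => //=; rewrite normr0.
exists `|K| => _ [v /= v1 <-].
rewrite (le_trans (ler_norm _))// (le_trans (hK v))//.
by rewrite (le_trans (ler_wpM2r _ (ler_norm K)))// ler_piMr.
Qed.

Lemma le_dual_norm p v : p v <= dual_norm p * `|v|.
Proof.
have [->|v0] := eqVneq v 0; first by rewrite linear0 normr0 mulr0.
rewrite -ler_pdivrMr ?normr_gt0// mulrC.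
have <- : p (`|v|^-1 *: v) = `|v|^-1 * p v by rewrite dualZ.
apply: ub_le_sup; first by have [] := dual_has_sup p.
exists (`|v|^-1 *: v) => //=.
by rewrite normrZ normfV normr_id mulVf ?normr_eq0.
Qed.

Lemma dual_norm_ge0 p : 0 <= dual_norm p.
Proof.
apply: ub_le_sup; first by have [] := dual_has_sup p.
by exists 0; rewrite ?linear0//= normr0.
Qed.

Lemma dual_norm_le p (M : R) :
  (forall v, `|v| <= 1 -> p v <= M) -> dual_norm p <= M.
Proof.
move=> pM; apply: ge_sup; first by have [] := dual_has_sup p.
by move=> _ [v /= v1 <-]; exact: pM.
Qed.

Lemma dual_normZ_le (h : R) p : 0 <= h ->
  dual_norm (h \*: p) <= h * dual_norm p.
Proof.
move=> h0; apply: (dual_norm_le (h \*: p : {linear E -> R^o})) => v v1.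
rewrite /= ler_wpM2l// (le_trans (le_dual_norm p v))//.
by rewrite ler_piMr// dual_norm_ge0.
Qed.

End Dual.

(** From an interior point a short move in any direction stays in [Q], and along it the subgradient
    inequality meets the Lipschitz bound. *)
Lemma dual_norm_subgradient_le (R : realType) (E : finNormedModType R)
    (Q : set E) (f : E -> R) (M : R) (x : E) (p : dual E) :
  0 <= M -> M.-lipschitz_Q (f : E -> R^o) -> interior Q x ->
  is_subgradient Q f x p -> dual_norm p <= M.
Proof.
move=> M0 fL /nbhs_ballP[r r0 hr] fp; apply: dual_norm_le => v v1.
have Q1 t : 0 <= t < r -> Q (x + t *: v).
  move=> /andP[t0 tr]; apply: hr; rewrite -ball_normE /= opprD addNKr normrN.
  by rewrite normrZ ger0_norm// (le_lt_trans _ tr)// ler_piMr.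
have r2 : 0 < r / 2 by rewrite divr_gt0.
have Qx : Q x by rewrite -[x]addr0 -(scale0r v); apply: Q1; rewrite lexx.
have Qv : Q (x + (r / 2) *: v).
  by apply: Q1; rewrite (ltW r2) ltr_pdivrMr// ltr_pMr// ltr1n.
have := fp _ Qv; have := fL (x + (r / 2) *: v, x) (conj Qv Qx).
rewrite /= [x + _]addrC addrK dualZ normrZ gtr0_norm// => Lf fv.
have : r / 2 * p v <= M * (r / 2 * `|v|).
  by apply: le_trans Lf; rewrite (le_trans _ (ler_norm _))// lerBrDl.
rewrite mulrCA ler_pM2l// => /le_trans; apply.
by rewrite ler_piMr.
Qed.

(** * Derivatives and the mean value theorem on a segment *)

Lemma is_derive1_dist (R : realType) (F : R -> R) (t l : R) :
  (forall e, 0 < e -> exists2 r, 0 < r &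
    forall h, `|h| < r -> `|F (t + h) - F t - h * l| <= e * `|h|) ->
  is_derive t 1 F l.
Proof.
move=> hF.
have cF : h^-1 *: ((F \o shift t) (h *: 1) - F t) @[h --> 0^'] --> (l : R).
  apply/cvgrPdist_le => e e0; have [r r0 hr] := hF e e0.
  near=> h.
  have h0 : h != 0 by near: h; exact: nbhs_dnbhs_neq.
  have hlt : `|h| < r by near: h; exact: dnbhs0_lt.
  have := hr h hlt.
  rewrite /= -ler_pdivrMr ?normr_gt0// -normfV -normrM.
  have -> : l - h^-1 *: (F (h *: 1 + t) - F t) =
      - ((F (t + h) - F t - h * l) / h).
    rewrite [h *: 1]mulr1 [h + t]addrC -[_^-1 *: _]/(_^-1 * _).
    by field.
  by rewrite normrN.
apply: DeriveDef; first by apply/cvg_ex; exists l.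
exact: cvg_lim cF.
Unshelve. all: by end_near. Qed.

(* Only points of [0, 1] are tested: F stands for a function on Q restricted
   to a segment, and nothing is known about it outside Q. *)
Lemma MVT_dist (R : realType) (F f : R -> R) :
  (forall t, 0 <= t <= 1 -> forall e, 0 < e -> exists2 r, 0 < r &
    forall h, 0 <= t + h <= 1 -> `|h| < r ->
      `|F (t + h) - F t - h * f t| <= e * `|h|) ->
  exists2 c, 0 < c < 1 & F 1 - F 0 = f c.
Proof.
move=> Fdist.
have Fder (t : R) : t \in `]0, 1[ -> is_derive t 1 F (f t).
  rewrite in_itv /= => /andP[t0 t1].
  apply: is_derive1_dist => e e0.
  have [|r r0 hr] := Fdist t _ e e0; first by rewrite !ltW.
  (* The bounds [t] and [1 - t] keep [t + h] inside [0, 1]. *)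
  exists (Num.min r (Num.min t (1 - t))) => [|h].
    by rewrite !lt_min r0 t0 subr_gt0.
  rewrite !lt_min => /and3P[hlt]; rewrite ltr_norml => /andP[h1 _].
  by rewrite ltr_norml => /andP[_ h2]; apply: hr => //; lra.
have Fcont : {within `[0, 1], continuous F}.
  apply/subspace_continuousP => t; rewrite /= in_itv /= => t01.
  apply/cvgrPdist_le => e e0.
  have [r r0 hr] := Fdist t t01 1 ltr01.
  (* With tolerance 1, [K] is a local Lipschitz constant of [F] at [t]. *)
  pose K := 1 + `|f t|.
  have K0 : 0 < K by rewrite ltr_wpDr.
  apply/nbhs_ballP; exists (Num.min r (e / K)) => [|s].
    by rewrite /= lt_min r0 divr_gt0.
  rewrite -ball_normE /= distrC lt_min => /andP[sr se].
  rewrite in_itv /= => s01.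
  have := hr (s - t); rewrite addrC subrK => /(_ s01 sr) Fs.
  rewrite distrC -[F s - F t](subrK ((s - t) * f t)).
  rewrite (le_trans (ler_normD _ _))//.
  rewrite ltr_pdivlMr// in se; rewrite (le_trans _ (ltW se))// normrM.
  by rewrite (le_trans (lerD Fs (lexx _)))// mulrDr mulr1 mul1r.
have [c] := MVT ltr01 Fder Fcont.
by rewrite in_itv /= subr0 mulr1; exists c.
Qed.

(** * First-order optimality, the Bregman divergence and mirror steps *)

Section FirstOrder.
Context {R : realType} {E : finNormedModType R}.
Variables (Q : set E) (d : E -> R) (gd : E -> dual E).
Hypotheses (Qcv : convex_set Q) (dC1 : is_C1_on Q d gd).

Lemma convex_segment {x y t} :
  Q x -> Q y -> 0 <= t <= 1 -> Q (x + t *: (y - x)).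
Proof.
move=> Qx Qy /andP[t0 t1].
have := Qcv y x (Itv01 t0 t1); rewrite !inE => /(_ Qy Qx).
congr Q; rewrite /conv /= /unstable.onem scalerBl scale1r scalerBr.
by rewrite addrCA.
Qed.

Lemma C1_dist {x} : Q x -> forall e, 0 < e -> exists2 r, 0 < r &
  forall y, Q y -> `|y - x| < r -> `|d y - d x - gd x (y - x)| <= e * `|y - x|.
Proof.
move=> /dC1[/eqoP od _] e e0.
have /nbhs_ballP[r r0 hr] := od e e0.
exists r => // y Qy yx; apply: hr => //.
by rewrite -ball_normE /= distrC.
Qed.

Lemma argmin_first_order {l : dual E} {u} :
  is_argmin Q (fun v => l v + d v) u ->
  forall v, Q v -> 0 <= l (v - u) + gd u (v - u).
Proof.
move=> [Qu minu] v Qv; rewrite leNgt; apply/negP => a0.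
set w := v - u in a0 *; set a := l w + gd u w in a0.
have w1 : 0 < `|w| + 1 by rewrite ltr_wpDl.
(* With this tolerance the remainder of [d] on the step [t *: w] is at most [t * (- a / 2)], half of
   the first-order decrease; adding 1 avoids dividing by a zero norm. *)
have e0 : 0 < - a / (2 * (`|w| + 1)) by rewrite divr_gt0// ?oppr_gt0// mulr_gt0.
have [r r0 hr] := C1_dist Qu _ e0.
pose t := Num.min 1 (r / (`|w| + 1)).
have t0 : 0 < t by rewrite lt_min ltr01 divr_gt0.
have t1 : t <= 1 by rewrite ge_min lexx.
have Qt : Q (u + t *: w) by apply: convex_segment => //; rewrite ltW.
have tw : t * `|w| < r.
  have : t * (`|w| + 1) <= r by rewrite -ler_pdivlMr// ge_min lexx orbT.
  by apply: lt_le_trans; rewrite ltr_pM2l// ltrDl.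
have := hr _ Qt; have := minu _ Qt.
rewrite [u + _]addrC addrK linearD !dualZ normrZ gtr0_norm//.
move=> mind /(_ tw); rewrite ler_norml => /andP[_].
have -> : - a / (2 * (`|w| + 1)) * (t * `|w|) =
    t * (- a / 2 * (`|w| / (`|w| + 1))) by field; rewrite gt_eqF.
have : `|w| / (`|w| + 1) <= 1 by rewrite ler_pdivrMr// mul1r lerDl.
have : 0 <= t * (- a / 2).
  by rewrite mulr_ge0 ?ltW// divr_gt0// oppr_gt0.
have : t * a < 0 by rewrite pmulr_rlt0.
rewrite /a; nra.
Qed.

(** The difference of the two sides is [G 1 - G 0], which equals some [G' c]; strong convexity
    between [x + c *: v] and [x] makes [G' c] nonnegative. *)
Lemma bregman_ge {x y} : strongly_convex1 Q gd -> Q x -> Q y ->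
  `|y - x| ^+ 2 / 2 <= bregman d gd x y.
Proof.
move=> dsc Qx Qy; set v := y - x.
pose G s := d (x + s *: v) - s * gd x v - s ^+ 2 / 2 * `|v| ^+ 2.
pose G' s := gd (x + s *: v) v - gd x v - s * `|v| ^+ 2.
have [|c /andP[c0 c1]] := MVT_dist R G G'.
  move=> t t01 e e0.
  have v1 : 0 < `|v| + 1 by rewrite ltr_wpDl.
  have e'0 : 0 < e / 2 / (`|v| + 1) by rewrite !divr_gt0.
  have [r r0 hr] := C1_dist (convex_segment Qx Qy t01) _ e'0.
  (* The first radius controls the remainder of [d], the second the quadratic term; each gets half
     of [e]. *)
  exists (Num.min (r / (`|v| + 1)) (e / (`|v| ^+ 2 + 1))) => [|h th].
    by rewrite lt_min !divr_gt0// ltr_wpDl.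
  rewrite lt_min !ltr_pdivlMr// ?ltr_wpDl// => /andP[hlt1 hlt2].
  have := hr _ (convex_segment Qx Qy th).
  have -> : x + (t + h) *: (y - x) - (x + t *: (y - x)) = h *: v.
    by rewrite opprD addrACA subrr add0r scalerDl addrAC subrr add0r.
  rewrite dualZ normrZ -/v => /(_ _) hd.
  have -> : G (t + h) - G t - h * G' t =
      (d (x + (t + h) *: v) - d (x + t *: v) - h * gd (x + t *: v) v)
      - h ^+ 2 / 2 * `|v| ^+ 2.
    by rewrite /G /G'; field.
  rewrite (le_trans (ler_normB _ _))//.
  rewrite [e]splitr mulrDl lerD//.
    apply: (le_trans (hd _)).
      by rewrite (le_lt_trans _ hlt1)// ler_wpM2l// lerDl.
    have -> : e / 2 / (`|v| + 1) * (`|h| * `|v|) =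
        e / 2 * `|h| * (`|v| / (`|v| + 1)) by field; rewrite gt_eqF.
    rewrite ler_piMr ?mulr_ge0 ?divr_ge0 ?(ltW e0)//.
    by rewrite ler_pdivrMr// mul1r lerDl.
  rewrite ger0_norm; last by rewrite mulr_ge0 ?exprn_ge0// divr_ge0 ?sqr_ge0.
  rewrite -real_normK ?num_real//.
  have : `|h| * (`|h| * (`|v| ^+ 2 + 1)) <= `|h| * e by rewrite ler_wpM2l// ltW.
  have := sqr_ge0 `|h|; nra.
have Qc : Q (x + c *: v) by apply: convex_segment => //; rewrite !ltW.
have := dsc _ _ Qc Qx.
rewrite [x + _]addrC addrK !dualZ normrZ gtr0_norm// [_ + x]addrC.
have yE : x + 1 *: v = y by rewrite scale1r /v addrC subrK.
rewrite /G /G' yE scale0r addr0 /bregman -/v => cv GE.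
have : 0 <= c * (gd (x + c *: v) v - gd x v - c * `|v| ^+ 2) by nra.
rewrite pmulr_rge0//; nra.
Qed.

(** Optimality of [x'] tested at [v] reads q(x' - v) <= V(x, v) - V(x', v) - V(x, x'); the term V(x,
    x') absorbs the quadratic part of q(x - x'). *)
Lemma mirr_descent {x x' v : E} {q : dual E} : strongly_convex1 Q gd ->
  Q x -> Q v -> is_Mirr Q d gd x q x' ->
  q (x - v) <= dual_norm q ^+ 2 / 2 + bregman d gd x v - bregman d gd x' v.
Proof.
move=> dsc Qx Qv mirr; have Qx' : Q x' by case: mirr.
(* This objective differs from that of the mirror step by a constant. *)
have : is_argmin Q (fun w => (q \- gd x : {linear E -> R^o}) w + d w) x'.
  split=> // w Qw; have := mirr.2 w Qw.
  rewrite /bregman /= !dualB; lra.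
move=> /argmin_first_order/(_ v Qv) /=.
have := bregman_ge dsc Qx Qx'.
have := le_dual_norm q (x - x').
have := sqr_ge0 (dual_norm q - `|x' - x|).
rewrite [`|x - x'|]distrC /bregman !dualB; nra.
Qed.

Lemma mirr_progress {x x' v : E} {p : dual E} {eps : R} :
  strongly_convex1 Q gd -> 0 < eps -> Q x -> Q v ->
  is_Mirr Q d gd x ((eps / dual_norm p) \*: p) x' ->
  eps * dual_norm p < p (x - v) ->
  eps ^+ 2 / 2 < bregman d gd x v - bregman d gd x' v.
Proof.
move=> dsc eps0 Qx Qv mirr pxv.
(* If this norm were 0, the strict inequality would fail, so the step length is a genuine
   quotient. *)
have p0 : 0 < dual_norm p.
  rewrite lt_neqAle dual_norm_ge0 andbT eq_sym; apply: contraL pxv => /eqP p0.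
  by rewrite -leNgt p0 mulr0 (le_trans (le_dual_norm _ _))// p0 mul0r.
have := mirr_descent dsc Qx Qv mirr.
rewrite -[X in X <= _]/(eps / dual_norm p * p (x - v)).
have := dual_normZ_le (eps / dual_norm p) p (ltW (divr_gt0 eps0 p0)).
rewrite divfK ?gt_eqF// => qe.
have q2 : dual_norm ((eps / dual_norm p) \*: p) ^+ 2 <= eps ^+ 2.
  rewrite ler_pXn2r ?nnegrE ?(ltW eps0)//.
  exact: (dual_norm_ge0 ((eps / dual_norm p) \*: p : {linear E -> R^o})).
have : eps ^+ 2 < eps / dual_norm p * p (x - v).
  by rewrite mulrAC ltr_pdivlMr// expr2 -mulrA ltr_pM2l.
lra.
Qed.

End FirstOrder.

(* f, g and d are defined on Q: their values outside Q are never used.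
   gf x and gg x are the subgradients of f and g at x used by the algorithm.
   At interior points of Q, the bound dual_norm (gf x) <= Mf follows from the
   Lipschitz condition; at the other points of Q, subgradients satisfying it
   exist but others do not satisfy it, and the result fails for those. *)
Theorem corollary3p2 (R : realType) (E : finNormedModType R)
    (Q : set E) (hQcl : closed Q) (hQcv : convex_set Q)
    (d : E -> R) (gd : E -> dual E)
    (hd0 : forall x, Q x -> 0 <= d x)
    (hdC1 : is_C1_on Q d gd)
    (hdsc : strongly_convex1 Q gd)
    (f : E -> R) (gf : E -> dual E) (Mf : R)
    (hfcv : convex_function Q f)
    (hMf : 0 <= Mf)
    (hfL : Mf.-lipschitz_Q (f : E -> R^o))
    (hgf : forall x, Q x -> is_subgradient Q f x (gf x))
    (hgfM : forall x, Q x -> ~ interior Q x -> dual_norm (gf x) <= Mf)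
    (g : E -> R) (gg : E -> dual E) (Mg : R)
    (hgcv : convex_function Q g)
    (hgL : Mg.-lipschitz_Q (g : E -> R^o))
    (hgg : forall x, Q x -> is_subgradient Q g x (gg x))
    (xstar : E)
    (hxstar : is_argmin [set x | Q x /\ g x <= 0] f xstar)
    (Theta0 : R) (hTheta0 : d xstar <= Theta0 ^+ 2)
    (eps : R) (heps : 0 < eps)
    (x : nat -> E) (N : nat)
    (hrun : amd_run Q d gd g gf gg Theta0 eps x N) :
  (\big[Order.min/+oo]_(k <- productive_steps g gg eps x N) (f (x k))%:E
     - (f xstar)%:E <= (Mf * eps)%:E)%E.
Proof.
have [x0min hstep N0 hN _] := hrun.
have [[Qs gs0] _] := hxstar.
have Qx k : (k <= N)%N -> Q (x k).
  by case: k => [_|k /hstep[]//]; case: x0min.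
(* The second case includes an empty set of productive steps, where the minimum is [+oo]. *)
have [[k kN fk]|noprod] := pselect (exists2 k,
    k \in productive_steps g gg eps x N & f (x k) - f xstar <= Mf * eps).
  rewrite leeBlDr//.
  by apply: (bigmin_inf_seq _ k) => //; rewrite -EFinD lee_fin -lerBlDr.
exfalso; pose V k := bregman d gd (x k) xstar.
have progress k : (k < N)%N -> eps ^+ 2 / 2 < V k - V k.+1.
  move=> kN; have Qk := Qx k (ltnW kN); have := hstep k kN.
  rewrite /amd_step; case: ifPn => prod mirr.
    apply: (mirr_progress Q d gd hQcv hdC1 hdsc heps Qk Qs mirr).
    have gfM : dual_norm (gf (x k)) <= Mf.
      have [intQk|/(hgfM _ Qk)//] := pselect (interior Q (x k)).
      exact: (dual_norm_subgradient_le R E Q f Mf _ _ hMf hfL intQk (hgf _ Qk)).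
    have : Mf * eps < f (x k) - f xstar.
      rewrite ltNge; apply/negP => fk; apply: noprod; exists k => //.
      by rewrite mem_filter prod mem_iota.
    have := hgf _ Qk _ Qs; rewrite !dualB.
    have := ler_wpM2l (ltW heps) gfM; lra.
  apply: (mirr_progress Q d gd hQcv hdC1 hdsc heps Qk Qs mirr).
  move: prod; rewrite /productive -ltNge.
  by have := hgg _ Qk _ Qs; rewrite !dualB; lra.
have VN k : (k < N)%N -> k.+1%:R * (eps ^+ 2 / 2) < V 0%N - V k.+1.
  elim: k => [|k IH] kN; first by rewrite mul1r progress.
  have := IH (ltnW kN); have := progress _ kN.
  by rewrite -[in X in _ -> _ -> X]natr1 mulrDl mul1r; lra.
have V0 : V 0%N <= Theta0 ^+ 2.
  apply: le_trans hTheta0; rewrite /V /bregman.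
  (* First-order optimality with zero linear part makes the gradient term of [V 0] nonnegative, so
     [V 0] is at most [d xstar - d (x 0)]. *)
  have min0 : is_argmin Q (fun v => (\0 : {linear E -> R^o}) v + d v) (x 0%N).
    by split=> [|v Qv]; [case: x0min|rewrite /= !add0r; exact: x0min.2].
  have := argmin_first_order Q d gd hQcv hdC1 min0 xstar Qs.
  by have := hd0 _ (Qx 0%N isT); rewrite /= add0r; lra.
have VNge0 : 0 <= V N.
  apply: le_trans (bregman_ge Q d gd hQcv hdC1 hdsc (Qx N (leqnn N)) Qs).
  by rewrite divr_ge0 ?sqr_ge0.
have := VN N.-1; rewrite prednK// => /(_ (leqnn _)).
move: hN; rewrite ler_pdivrMr ?exprn_gt0//; lra.
Qed.
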